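(* Let $L$ and $L'$ be languages (with value sets $\mathbf V$, $\mathbf V'$) that both satisfy the Head Postulate and the Alpha Postulate, and let $R\subseteq\mathbf V'\times\mathbf V$ be a semantic translation. If there exists a translation from $L$ into $L'$ that is correct w.r.t. $R^\alpha$, then there exists a compositional translation from $L$ into $L'$ that is correct w.r.t. $R^\alpha$.
   Context: Fix a sufficiently large (infinite) set $\mathcal V$ of variables. A language $L$ has a set $\mathbb T_L$ of expressions built inductively from variables $X\in\mathcal V$ by operators $f(E_1,\dots,E_n)$ and possibly other constructs, which may take arbitrarily many arguments and may bind variables in some arguments; $\mathrm{fv}(E)$ denotes the free variables of $E$. Its semantics is a map $[\![\cdot]\!]_L:\mathbb T_L\to((\mathcal V\to\mathbf V)\to\mathbf V)$ with $[\![X]\!]_L(\rho)=\rho(X)$, where $[\![E]\!]_L(\rho)$ depends only on $\rho$ restricted to $\mathrm{fv}(E)$. A substitution is a partial map $\sigma:\mathcal V\rightharpoonup\mathbb T_L$; $E[\sigma]$ replaces free occurrences of each $X\in\mathrm{dom}(\sigma)$ by $\sigma(X)$, renaming bound variables to avoid capture. For a substitution $\sigma$ (extended by $\sigma(Y)=Y$ outside its domain) let $[\![\sigma]\!]_L(\rho)(X)=[\![\sigma(X)]\!]_L(\rho)$. Standing assumption on semantics: for all $E,\sigma,\rho$ there is $F$ $\alpha$-equivalent to $E$ with $[\![E[\sigma]]\!]_L(\rho)=[\![F]\!]_L([\![\sigma]\!]_L(\rho))$. $E=_\alpha F$ means $E$ can be turned into $F$ by renaming bound variables (avoiding capture). $E\le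 F$ ($E$ is a prefix of $F$) if $F=_\alpha E[\sigma]$ for some $\sigma$ with $\mathrm{dom}(\sigma)=\mathrm{fv}(E)$; $E\equiv F$ iff $E\le F$ and $F\le E$. A head is an expression $H\notin\mathcal V$ such that every $E\le H$ is a variable or satisfies $E\equiv H$; it is a head of $F$ if moreover $H\le F$. Head Postulate: every expression that is not a variable has a head, unique up to $\equiv$. For $v,w\in\mathbf V$ write $v\equiv^\alpha_L w$ iff there are $E=_\alpha F$ and a valuation $\zeta$ with $[\![E]\!]_L(\zeta)=v$, $[\![F]\!]_L(\zeta)=w$. Alpha Postulate: $\equiv^\alpha_L$ is an equivalence relation. A semantic translation is $R\subseteq\mathbf V'\times\mathbf V$ with every $v\in\mathbf V$ having some $v'$ with $v'Rv$; $R^\alpha$ is defined by $w R^\alpha v$ iff $w\equiv^\alpha_{L'}w' R v'\equiv^\alpha_L v$ for some $w',v'$. A translation $T:\mathbb T_L\to\mathbb T_{L'}$ is correct w.r.t. a relation $S\subseteq\mathbf V'\times\mathbf V$ if $[\![T(E)]\!]_{L'}(\eta)\,S\,[\![E]\!]_L(\rho)$ for all $E$ and all valuations with $\eta(X)S\rho(X)$ for all $X$. $T$ is compositional if (i) $T(E[\sigma])=_\alpha T(E)[T\circ\sigma]$ for all $E\in\mathbb T_L$ and $\sigma:\mathrm{fv}(E)\to\mathbb T_L$, (ii) $E=_\alpha F$ implies $T(E)=_\alpha T(F)$, and (iii) $T(X)=X$ for all $X\in\mathcal V$.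
   Formalization: The given correct translation is additionally required to map closed expressions to closed expressions (and the compositional one obtained does so too); without this the claim fails, e.g. when a constant must be translated to a variable. *)

(* Defs.v *)
From mathcomp Require Import all_boot all_classical.

Set Implicit Arguments.
Unset Strict Implicit.
Unset Printing Implicit Defensive.

Local Open Scope classical_set_scope.

(* A construct c takes arguments indexed by arg c (any type, so possibly      *)
(* infinitely many) and has binding slots binder c; each occurrence of c      *)
(* writes a variable in every slot, and the variable in slot b is bound in    *)
(* the i-th argument iff binds b i.  An ordinary operator has no slots.       *)
Record signature := Signature {
  construct : Type;
  arg : construct -> Type;
  binder : construct -> Type;
  binds : forall c, binder c -> arg c -> Prop }.

Section Syntax.
Variables (V : Type) (Sg : signature).

Inductive raw : Type :=
| Var of V
| Con (c : construct Sg) of binder c -> V & arg c -> raw.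

Definition bound (c : construct Sg) (xs : binder c -> V) (i : arg c) : set V :=
  [set xs b | b in [set b | binds b i]].

Fixpoint rfv (E : raw) : set V :=
  match E with
  | Var X => [set X]
  | Con c xs Es => \bigcup_i (rfv (Es i) `\` bound xs i)
  end.

(* Inside the i-th argument of a construct, whose slots are filled by xs on   *)
(* the left and by ys on the right, two variables correspond iff they are     *)
(* bound by the same slots, or both are unbound and correspond outside.       *)
Definition extend (c : construct Sg) (i : arg c) (xs ys : binder c -> V)
    (m : V -> V -> Prop) (x y : V) : Prop :=
  (forall b : binder c, binds b i -> (xs b = x <-> ys b = y)) /\
  (bound xs i x \/ m x y).

(* One expression is obtained from the other by renaming, at once and without *)
(* capture, all binding occurrences together with the occurrences they bind;  *)
(* m is the correspondence between the variables that are free.               *)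
Inductive alpha_wrt : (V -> V -> Prop) -> raw -> raw -> Prop :=
| alpha_Var (m : V -> V -> Prop) X Y : m X Y -> alpha_wrt m (Var X) (Var Y)
| alpha_Con m (c : construct Sg) (xs ys : binder c -> V)
      (Es Fs : arg c -> raw) :
    (forall i, alpha_wrt (extend i xs ys m) (Es i) (Fs i)) ->
    alpha_wrt m (Con xs Es) (Con ys Fs).

Definition ralpha : raw -> raw -> Prop := alpha_wrt eq.

Definition without (s : V -> option raw) (A : set V) (X : V) : option raw :=
  if `[< A X >] then None else s X.

(* Replacement of the free occurrences, without renaming of bound variables. *)
Fixpoint replace_free (s : V -> option raw) (E : raw) : raw :=
  match E with
  | Var X => odflt (Var X) (s X)
  | Con c xs Es =>
      Con xs (fun i => replace_free (without s (bound xs i)) (Es i))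
  end.

Fixpoint capture_free (s : V -> option raw) (E : raw) : Prop :=
  match E with
  | Var X => True
  | Con c xs Es => forall i,
      (forall X F, rfv (Es i) X -> without s (bound xs i) X = Some F ->
         rfv F `&` bound xs i = set0) /\
      capture_free (without s (bound xs i)) (Es i)
  end.

End Syntax.

Arguments Var {V Sg} X.
Arguments Con {V Sg c} xs Es.

(* Which raw terms are expressions is left to the language (e.g. a recursion  *)
(* construct may ask for distinct variables in its slots).  How E[s] renames  *)
(* bound variables is left to the language too; the existence of an operation *)
(* subst as required by substP is what makes V "sufficiently large" for the   *)
(* language: there are always enough fresh variables to avoid capture.        *)
Record language (V : Type) := Language {
  syntax : signature;
  valid : raw V syntax -> Prop;
  valid_Var : forall X, valid (Var X);
  valid_arg : forall (c : construct syntax) (xs : binder c -> V)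
      (Es : arg c -> raw V syntax),
    valid (Con xs Es) -> forall i, valid (Es i);
  subst : {E | valid E} -> (V -> option {E | valid E}) -> {E | valid E};
  substP : forall (E : {E | valid E}) (s : V -> option {E | valid E}),
    let s' X := omap sval (s X) in
    exists E' : {E | valid E},
      [/\ ralpha (sval E) (sval E'), capture_free s' (sval E')
        & sval (subst E s) = replace_free s' (sval E')];
  value : Type;
  sem : {E | valid E} -> (V -> value) -> value;
  sem_Var : forall X rho, sem (exist _ (Var X) (valid_Var X)) rho = rho X;
  sem_fv : forall (E : {E | valid E}) rho1 rho2,
    (forall X, rfv (sval E) X -> rho1 X = rho2 X) -> sem E rho1 = sem E rho2;
  sem_subst : forall (E : {E | valid E}) (s : V -> option {E | valid E}) rho,
    exists2 F : {E | valid E}, ralpha (sval F) (sval E) &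
      sem (subst E s) rho =
      sem F (fun X => sem (odflt (exist _ (Var X) (valid_Var X)) (s X)) rho) }.

Section Language.
Variables (V : Type) (L : language V).

Definition expr : Type := {E | @valid V L E}.

Definition evar (X : V) : expr := exist _ (Var X) (valid_Var L X).

Definition is_var (E : expr) : Prop := exists X, E = evar X.

Definition fv (E : expr) : set V := rfv (sval E).

Definition alpha (E F : expr) : Prop := ralpha (sval E) (sval F).

Definition substitution : Type := V -> option expr.

Definition dom (s : substitution) : set V := [set X | s X].

Definition is_prefix (E F : expr) : Prop :=
  exists2 s : substitution, dom s = fv E & alpha F (subst E s).

Definition prefix_equiv (E F : expr) : Prop := is_prefix E F /\ is_prefix F E.

Definition is_head (H : expr) : Prop :=
  ~ is_var H /\ forall E, is_prefix E H -> is_var E \/ prefix_equiv E H.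

Definition is_head_of (H F : expr) : Prop := is_head H /\ is_prefix H F.

Definition head_postulate : Prop :=
  forall F, ~ is_var F ->
    (exists H, is_head_of H F) /\
    (forall H1 H2, is_head_of H1 F -> is_head_of H2 F -> prefix_equiv H1 H2).

Definition val_alpha (v w : value L) : Prop :=
  exists E F (zeta : V -> value L),
    [/\ alpha E F, sem E zeta = v & sem F zeta = w].

Definition alpha_postulate : Prop := RelationClasses.Equivalence val_alpha.

End Language.

Section Translation.
Variables (V : Type) (L L' : language V).

Definition semantic_translation (R : value L' -> value L -> Prop) : Prop :=
  forall v, exists v', R v' v.

Definition rel_alpha (R : value L' -> value L -> Prop)
    (w : value L') (v : value L) : Prop :=
  exists w' v', [/\ val_alpha w w', R w' v' & val_alpha v' v].

Definition correct (S : value L' -> value L -> Prop)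
    (T : expr L -> expr L') : Prop :=
  forall E (eta : V -> value L') (rho : V -> value L),
    (forall X, S (eta X) (rho X)) -> S (sem (T E) eta) (sem E rho).

Definition compositional (T : expr L -> expr L') : Prop :=
  [/\ forall E (s : substitution L), dom s = fv E ->
        alpha (T (subst E s)) (subst (T E) (fun X => omap T (s X))),
      forall E F, alpha E F -> alpha (T E) (T F)
    & forall X, T (evar L X) = evar L' X].

(* Required of translations: otherwise a constant c may be correctly          *)
(* translated to a variable Y, and then no compositional correct translation  *)
(* need exist, since in the translation of g(c, Y), with g binary,            *)
(* substituting for Y also affects the translation of c.                      *)
Definition preserves_closed (T : expr L -> expr L') : Prop :=
  forall E, fv E = set0 -> fv (T E) = set0.

End Translation.

(* Main.v *)
(* Every non-variable E is, uniquely up to renaming, H[d] where H is the chosen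
   representative of its class of heads, and the d(X) with X free in H correspond
   to proper subterms of E.  Given a correct translation T1, let T0 identify the
   variables of T1(H) that are not free in H with one that is, and recursively put
   T(H[d]) = T0(H)[T o d].  Compositionality holds because E and E[s] have the same
   heads, so that E[s] decomposes as H[d[s]]; correctness passes from T1 to T0 and
   then to T by induction along this decomposition.

   Substitution up to renaming is handled through a relation that generalizes
   alpha-conversion by relating variables to expressions, which spares all choices
   of fresh variables. *)
Require Import Defs.
From mathcomp Require Import all_boot all_classical.
From Stdlib Require Eqdep.

Local Open Scope classical_set_scope.

(** * Substitution and renaming of raw terms as relations *)

Section RelationalSubstitution.
Set Implicit Arguments.
Unset Strict Implicit.
Context {V : Type} {Sg : signature}.
Implicit Types (m n k : V -> raw V Sg -> Prop) (E F G : raw V Sg).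

(** [extend] with expressions on the right; the last conjunct rules out capture. *)
Definition under_binder {c : construct Sg} (i : arg c) (xs ys : binder c -> V) m
    (X : V) F : Prop :=
  (exists Y, [/\ F = Var Y, bound xs i X
     & forall b, binds b i -> (xs b = X <-> ys b = Y)]) \/
  [/\ ~ bound xs i X, m X F & forall Y, rfv F Y -> ~ bound ys i Y].

(* [F] arises from [E] by capture-avoiding replacement of each free occurrence
   of each [X] by some [G] with [m X G], bound variables being renamed at will. *)
Fixpoint subst_rel m E F : Prop :=
  match E with
  | Var X => m X F
  | @Con _ _ c xs Es => exists (ys : binder c -> V) (Fs : arg c -> raw V Sg),
      F = Con ys Fs /\ forall i, subst_rel (under_binder i xs ys m) (Es i) (Fs i)
  end.

Lemma Con_inj (c : construct Sg) (xs ys : binder c -> V) (Es Fs : arg c -> raw V Sg) :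
  Con xs Es = Con ys Fs -> xs = ys /\ Es = Fs.
Proof.
move=> e; injection e => e1 e2; split.
  exact: (Eqdep.EqdepTheory.inj_pair2 _ (fun c : construct Sg => binder c -> V)).
exact: (Eqdep.EqdepTheory.inj_pair2 _ (fun c : construct Sg => arg c -> raw V Sg)).
Qed.

(** Both restrictions on the premise are for passing binders: [rfv E X] discards bound variables,
    and [rfv G] inside [rfv F] shows images uncaptured, as in [subst_rel_functional]. *)
Lemma subst_rel_mono m n E F :
  (forall X G, rfv E X -> rfv G `<=` rfv F -> m X G -> n X G) ->
  subst_rel m E F -> subst_rel n E F.
Proof.
elim: E m n F => [X|c xs Es IH] m n F mn /=; first exact: mn.
move=> [ys [Fs [eF EF]]]; rewrite eF in mn *.
exists ys, Fs; split=> // i; apply: IH (EF i) => X G EX GF [lXG|[nX mXG dG]]; [by left|right; split=> //].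
apply: mn => //=; first by exists i.
by move=> Y GY /=; exists i => //; split; [exact: GF|exact: dG].
Qed.

Lemma subst_rel_fv m E F Y :
  subst_rel m E F -> rfv F Y -> exists X G, [/\ rfv E X, m X G & rfv G Y].
Proof.
elim: E m F => [X|c xs Es IH] m F /=; first by move=> mXF FY; exists X, F.
move=> [ys [Fs [-> EF]]] [i _ [/= FY nY]].
have [X [G [EX [[Z [eG [b bi eX] XZ]]|[nX mXG dG]] GY]]] := IH _ _ _ (EF i) FY.
  by case: nY; exists b => //; move: GY; rewrite eG /= => ->; apply/XZ.
by exists X, G; split=> //; exists i.
Qed.

Definition arg_of E F : Prop :=
  match F with Var _ => False | Con _ _ Fs => exists i, Fs i = E end.

Inductive subterm E : raw V Sg -> Prop :=
| subterm_refl : subterm E E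
| subterm_arg F G : subterm E F -> arg_of F G -> subterm E G.

(** The image is a subterm of [F] itself, not just up to renaming; [smaller_wf] rests on this. *)
Lemma subst_rel_occurs m E F X : subst_rel m E F -> rfv E X ->
  exists G, [/\ m X G, rfv G `<=` rfv F & subterm G F].
Proof.
elim: E m F => [Y|c xs Es IH] m F /=.
  by move=> mF ->; exists F; split=> //; exact: subterm_refl.
move=> [ys [Fs [-> EF]]] [i _ [/= EX nX]].
have [G [[[Y [_ //]]|[_ mG dG]] GF sG]] := IH _ _ _ (EF i) EX.
exists G; split=> //; last by apply: subterm_arg sG _; exists i.
by move=> Y GY /=; exists i => //; split; [exact: GF|exact: dG].
Qed.

Lemma subst_rel_refl E : subst_rel (fun X G => G = Var X) E E.
Proof.
elim: E => [X|c xs Es IH] //=; exists xs, Es; split=> // i.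
apply: subst_rel_mono (IH i) => X G EX _ ->.
have [bX|nX] := pselect (bound xs i X); first by left; exists X.
by right; split=> // Y ->.
Qed.

Lemma subst_rel_trans m n E F G : subst_rel m E F -> subst_rel n F G ->
  subst_rel (fun X G => exists2 F, m X F & subst_rel n F G) E G.
Proof.
elim: E m n F G => [X|c xs Es IH] m n F G /=; first by move=> ? ?; exists F.
move=> [ys [Fs [-> EF]]] /= [zs [Gs [-> FG]]]; exists zs, Gs; split=> // i.
apply: subst_rel_mono (IH _ _ _ _ _ (EF i) (FG i)) => X G' EX _ [F'].
case=> [[Y [-> bX XY]] /= [[Z [-> bY YZ]]|[nY _ _]]|[nX mF dF] FG'].
- left; exists Z; split=> // b bi; split; first by move/(XY _ bi)/(YZ _ bi).
  by move/(YZ _ bi)/(XY _ bi).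
- by case: bX => b bi /(XY _ bi) e; case: nY; exists b.
(* No variable of [F'] is bound by [ys], so on [F'] the relation under the binder reduces to [n]. *)
- right; split=> //.
    exists F' => //; apply: subst_rel_mono FG' => Y H FY _.
    by move: (dF _ FY) => nY [[? [_ /nY//]]|[]].
  move=> Z GZ; have [Y [H [FY YH HZ]]] := subst_rel_fv FG' GZ.
  move: (dF _ FY) => nY.
  by case: YH => [[? [_ /nY//]]|[_ _]]; exact.
Qed.

(** With [k] the identity relation this makes substitution well defined up to renaming; with [n] the
    identity as well it yields symmetry of renaming. *)
Lemma subst_rel_functional m n k E F G :
  subst_rel m E F -> subst_rel n E G ->
  (forall X F' G', rfv E X -> m X F' -> n X G' -> subst_rel k F' G') ->
  subst_rel k F G.
Proof.
elim: E m n k F G => [X|c xs Es IH] m n k F G /=; first by move=> ? ?; exact.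
move=> [ys [Fs [-> EF]]] [zs [Gs [-> EG]]] mnk /=.
exists zs, Gs; split=> // i; apply: IH (EF i) (EG i) _ => X F' G' EX.
case=> [[Y [-> bX XY]]|[nX mF dF]] [[Z [-> bX' XZ]]|[nX' nG dG]] //=.
  left; exists Z; split=> //.
    by case: bX => b bi /(XY _ bi) e; exists b.
  move=> b bi; split; first by move/(XY _ bi)/(XZ _ bi).
  by move/(XZ _ bi)/(XY _ bi).
have EX' : rfv (Con xs Es) X by rewrite /=; exists i.
apply: subst_rel_mono (mnk _ _ _ EX' mF nG) => Y H FY HG kH.
by right; split=> // [|Z /HG]; [exact: dF|exact: dG].
Qed.

(** Cancellation, converse to [subst_rel_functional]: both instances keep the constructs of [E], so
    relating them relates the images at each free occurrence. *)
Lemma subst_rel_inj m n k E F G X :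
  subst_rel m E F -> subst_rel n E G -> subst_rel k F G -> rfv E X ->
  exists F' G', [/\ m X F', n X G' & subst_rel k F' G'].
Proof.
elim: E m n k F G => [Y|c xs Es IH] m n k F G /=.
  by move=> ? ? ? ->; exists F, G.
move=> [ys [Fs [-> EF]]] [zs [Gs [-> EG]]] /= [zs' [Gs' [/Con_inj[<- <-] FG]]].
move=> [i _ [/= EX nX]].
have [F' [G' [[[? [_ //]]|[_ mF dF]] [[? [_ //]]|[_ nG dG]] FG']]] :=
  IH _ _ _ _ _ _ (EF i) (EG i) (FG i) EX.
exists F', G'; split=> //; apply: subst_rel_mono FG' => Y H FY _.
by move: (dF _ FY) => nY [[? [_ /nY//]]|[]].
Qed.

Lemma alpha_wrtP (r : V -> V -> Prop) E F : alpha_wrt r E F <->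
  subst_rel (fun X G => exists2 Y, G = Var Y & r X Y) E F.
Proof.
split.
  elim=> {r E F} [r X Y rXY|r c xs ys Es Fs _ IH] /=; first by exists Y.
  exists ys, Fs; split=> // i; apply: subst_rel_mono (IH i) => X G EX _.
  move=> [Y -> [XY bXY]].
  have [bX|nX] := pselect (bound xs i X); first by left; exists Y.
  case: bXY => // rXY; right; split=> //; first by exists Y.
  by move=> _ -> [b bi /(XY _ bi) e]; case: nX; exists b.
(* Passing a binder changes the shape of the relation, so the induction covers every [m] contained
   in the correspondence. *)
suff gen m : (forall X G, m X G -> exists2 Y, G = Var Y & r X Y) ->
    subst_rel m E F -> alpha_wrt r E F by exact: gen.
elim: E F r m => [X|c xs Es IH] F r m mr /=.
  by move=> /mr[Y -> ?]; constructor.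
move=> [ys [Fs [-> EF]]]; constructor=> i; apply: IH (EF i) => X G.
case=> [[Y [-> bX XY]]|[nX /mr[Y -> rXY] dG]]; exists Y => //; first by split=> //; left.
split; last by right.
move=> b bi; split=> e; first by case: nX; exists b.
by case: (dG Y) => //; exists b.
Qed.

Lemma ralphaP E F : ralpha E F <-> subst_rel (fun X G => G = Var X) E F.
Proof.
rewrite /ralpha alpha_wrtP.
by split; apply: subst_rel_mono => X G _ _; [case=> Y -> ->|move=> ->; exists X].
Qed.

Lemma ralpha_refl E : ralpha E E.
Proof. exact/ralphaP/subst_rel_refl. Qed.

Lemma ralpha_sym E F : ralpha E F -> ralpha F E.
Proof.
move=> /ralphaP EF; apply/ralphaP.
by apply: subst_rel_functional EF (subst_rel_refl E) _ => X _ _ _ -> ->.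
Qed.

Lemma subst_rel_alphal m E F G :
  ralpha E F -> subst_rel m F G -> subst_rel m E G.
Proof.
move=> /ralphaP EF FG; apply: subst_rel_mono (subst_rel_trans EF FG).
by move=> X H _ _ [_ ->].
Qed.

Lemma ralpha_trans E F G : ralpha E F -> ralpha F G -> ralpha E G.
Proof. by move=> EF /ralphaP FG; exact/ralphaP/(subst_rel_alphal EF). Qed.

Lemma ralpha_fv E F : ralpha E F -> rfv E `<=` rfv F.
Proof.
move=> /ralpha_sym/ralphaP FE Y EY.
by have [X [_ [FX -> /= ->]]] := subst_rel_fv FE EY.
Qed.

Lemma subst_rel_replace_free (s : V -> option (raw V Sg)) E : capture_free s E ->
  subst_rel (fun X G => G = odflt (Var X) (s X)) E (replace_free s E).
Proof.
elim: E s => [X|c xs Es IH] s //= cE.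
exists xs; eexists; split; first by [].
move=> i; have [dE /IH] := cE i.
apply: subst_rel_mono => X G EX _ ->.
have [bX|nX] := pselect (bound xs i X).
  by left; exists X; split=> //; rewrite /without asboolT.
have e : without s (bound xs i) X = s X by rewrite /without asboolF.
rewrite e; right; split=> // Y; case eX: (s X) => [H|] /= HY bY.
  have d0 : rfv H `&` bound xs i = set0 by apply: dE EX _; rewrite e.
  by have : (rfv H `&` bound xs i) Y by []; rewrite d0.
by apply: nX; rewrite -HY.
Qed.

End RelationalSubstitution.

(** * Instances, prefixes and head decompositions of expressions *)

Section Expressions.
Set Implicit Arguments.
Unset Strict Implicit.
Context {V : Type} {L : language V}.
Implicit Types (E F G H : expr L) (s t u : V -> expr L).

(** Images count up to renaming, which makes the relation invariant under renaming on both sides; a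
    partial substitution is made total by [evar]. *)
Definition is_inst s E F : Prop :=
  subst_rel (fun X A => ralpha (sval (s X)) A) (sval E) (sval F).

Definition inst E s : expr L := subst E (fun X => Some (s X)).

Lemma is_inst_subst (p : substitution L) E :
  is_inst (fun X => odflt (evar L X) (p X)) E (subst E p).
Proof.
have /= [E' [EE' cE' e]] := substP E p; rewrite /is_inst e.
apply: subst_rel_alphal EE' _.
apply: subst_rel_mono (subst_rel_replace_free cE') => X G _ _ ->.
by case: (p X) => [F|]; exact: ralpha_refl.
Qed.

Lemma is_inst_inst E s : is_inst s E (inst E s).
Proof. exact: (is_inst_subst (fun X => Some (s X))). Qed.

Lemma is_inst_evar E F : is_inst (evar L) E F <-> alpha E F.
Proof.
rewrite /is_inst /alpha ralphaP.
by split; apply: subst_rel_mono => X G _ _ /=; rewrite ralphaP.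
Qed.

Lemma alpha_refl E : alpha E E. Proof. exact: ralpha_refl. Qed.

Lemma alpha_sym E F : alpha E F -> alpha F E. Proof. exact: ralpha_sym. Qed.

Lemma is_inst_unique s t E F G : is_inst s E F -> is_inst t E G ->
  (forall X, fv E X -> alpha (s X) (t X)) -> alpha F G.
Proof.
move=> EF EG st; apply/ralphaP; apply: subst_rel_functional EF EG _.
move=> X F' G' EX sF tG; apply/ralphaP.
exact: ralpha_trans (ralpha_sym sF) (ralpha_trans (st X EX) tG).
Qed.

Lemma is_inst_inj s t E F G X : is_inst s E F -> is_inst t E G -> alpha F G ->
  fv E X -> alpha (s X) (t X).
Proof.
move=> EF EG /ralphaP FG EX.
have [F' [G' [sF tG /ralphaP FG']]] := subst_rel_inj EF EG FG EX.
exact: ralpha_trans sF (ralpha_trans FG' (ralpha_sym tG)).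
Qed.

Lemma is_inst_comp s t u E F G : is_inst s E F -> is_inst t F G ->
  (forall X, fv E X -> is_inst t (s X) (u X)) -> is_inst u E G.
Proof.
move=> EF FG stu; apply: subst_rel_mono (subst_rel_trans EF FG) => X G' EX _ [F'].
move=> sF FG'; apply/ralphaP; apply: subst_rel_functional (stu X EX) _ _.
  exact: subst_rel_alphal sF FG'.
move=> Y A B _ sA sB; apply/ralphaP.
exact: ralpha_trans (ralpha_sym sA) sB.
Qed.

Lemma is_inst_alphar s E F G : is_inst s E F -> alpha F G -> is_inst s E G.
Proof.
move=> EF /is_inst_evar FG; apply: is_inst_comp EF FG _ => X _.
exact/is_inst_evar/alpha_refl.
Qed.

Lemma is_inst_eq s t E F : (forall X, fv E X -> alpha (s X) (t X)) ->
  is_inst s E F -> is_inst t E F.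
Proof.
move=> st EF; apply: subst_rel_mono EF => X G EX _ sG.
exact: ralpha_trans (ralpha_sym (st X EX)) sG.
Qed.

Lemma is_inst_Var s X F : is_inst s (evar L X) F <-> alpha (s X) F.
Proof. by []. Qed.

Lemma fv_is_inst s E F X : is_inst s E F -> fv E X -> fv (s X) `<=` fv F.
Proof.
move=> EF EX; have [G [sG GF _]] := subst_rel_occurs EF EX.
by move=> Y /(ralpha_fv sG)/GF.
Qed.

Lemma is_inst_fv s E F Y : is_inst s E F -> fv F Y ->
  exists2 X, fv E X & fv (s X) Y.
Proof.
move=> EF FY; have [X [G [EX sG GY]]] := subst_rel_fv EF FY.
by exists X => //; apply: ralpha_fv (ralpha_sym sG) _ GY.
Qed.

Lemma expr_eq E F : sval E = sval F -> E = F.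
Proof.
case: E F => [E vE] [F vF] /= e; rewrite e in vE *.
by congr exist; exact: Prop_irrelevance.
Qed.

Lemma is_inst_is_var s E F : is_inst s E F -> is_var F -> is_var E.
Proof.
case: E F => -[X|c xs Es] vE [F vF]; first by move=> _ _; exists X; exact: expr_eq.
by move=> [ys [Fs [/= eF _]]] [Y] [e]; rewrite e in eF.
Qed.

Lemma is_prefixP E F : is_prefix E F <-> exists s, is_inst s E F.
Proof.
split=> [[p _ FE]|[s EF]].
  by exists (fun X => odflt (evar L X) (p X)); apply: is_inst_alphar (alpha_sym FE);
     exact: is_inst_subst.
exists (fun X => if pselect (fv E X) then Some (s X) else None).
  by apply/seteqP; split=> X; rewrite /dom /=; case: (pselect (fv E X)).
apply: is_inst_unique EF (is_inst_subst _ _) _ => X EX /=.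
by case: (pselect (fv E X)) => //= _; exact: alpha_refl.
Qed.

Lemma is_prefix_trans E F G : is_prefix E F -> is_prefix F G -> is_prefix E G.
Proof.
move=> /is_prefixP[s EF] /is_prefixP[t FG]; apply/is_prefixP.
exists (fun X => inst (s X) t); apply: is_inst_comp EF FG _ => X _.
exact: is_inst_inst.
Qed.

(* The arguments of a non-variable prefix of [E] are, up to renaming, proper
   subterms of [E]. *)
Definition smaller F E : Prop :=
  exists H s X, [/\ ~ is_var H, is_inst s H E, fv H X & F = s X].

Lemma arg_of_wf : well_founded (@arg_of V (syntax L)).
Proof. by move=> A; elim: A => [X|c xs Es IH]; constructor=> B /= [] i <-. Qed.

Lemma smaller_wf : well_founded smaller.
Proof.
(* As [smaller] is blind to renaming, the induction on a raw [F] treats all renamings [E] of its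
   subterms. *)
suff gen (F G : raw V (syntax L)) E :
    subterm G F -> ralpha (sval E) G -> Acc smaller E.
  by move=> E; exact: gen (subterm_refl _) (ralpha_refl _).
elim/(well_founded_ind arg_of_wf): F G E => F IH G E GF EG.
have [eGF|[A AF GA]] : G = F \/ exists2 A, arg_of A F & subterm G A.
  by case: GF => [|A B GA AB]; [left|right; exists A].
2: exact: IH AF _ _ GA EG.
rewrite {G GF}eGF in EG.
constructor=> _ [H [s [X [nH HE HX ->]]]].
have HF : subst_rel (fun X A => ralpha (sval (s X)) A) (sval H) F.
  move: EG => /ralphaP EF; apply: subst_rel_mono (subst_rel_trans HE EF) => Y K _ _.
  by case=> K' sK /ralphaP KK'; exact: ralpha_trans sK KK'.
case: H nH HE HX HF => -[Y|c xs Es] vH nH HE HX /=.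
  by case: nH; exists Y; exact: expr_eq.
(* Since [H] is not a variable, [X] occurs inside an argument, so its image is a subterm of an
   argument of [F]. *)
move=> [ys [Fs [eF EF]]]; case: HX => i _ [/= EX nX].
have [K [[[? [_ //]]|[_ sK _]] _ KF]] := subst_rel_occurs (EF i) EX.
by apply: IH KF sK; rewrite eF; exists i.
Qed.

(* Extensionality in the set of heads makes the choice depend only on the
   [prefix_equiv]-class, hence invariant under renaming and substitution. *)
Lemma canonical_heads (X0 : V) : head_postulate L ->
  exists h : expr L -> expr L, forall E, ~ is_var E ->
    is_head_of (h E) E /\ forall s F, is_inst s E F -> h F = h E.
Proof.
move=> hp.
have /choice[f fP] (P : set (expr L)) : exists H, (exists H', P H') -> P H.
  have [[H PH]|nP] := pselect (exists H, P H); first by exists H.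
  by exists (evar L X0).
exists (fun E => f [set H | is_head_of H E]) => E nE.
have [[H HE] uE] := hp E nE.
split; first by apply: (fP [set K | is_head_of K E]); exists H.
move=> s F EF; congr f; apply/seteqP; split=> K [hK KF]; split=> //; last first.
  by apply: is_prefix_trans KF _; apply/is_prefixP; exists s.
have nF : ~ is_var F by move=> /(is_inst_is_var EF).
have [_ uF] := hp F nF.
(* [H] is also a head of [F], so uniqueness for [F] gives [K] below [H], hence below [E]. *)
have [KH _] : prefix_equiv K H.
  apply: uF; split=> //; first by case: HE.
  by apply: is_prefix_trans HE.2 _; apply/is_prefixP; exists s.
exact: is_prefix_trans KH HE.2.
Qed.

(** Fixing [d E] to be the identity off the head lets the recursion equation and the correctness
    proof range over all variables. *)
Definition head_decomposition (h : expr L -> expr L) (d : expr L -> V -> expr L) :=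
  forall E, ~ is_var E ->
    [/\ ~ is_var (h E), is_inst (d E) (h E) E,
        forall X, ~ fv (h E) X -> d E X = evar L X
      & forall s F, is_inst s E F -> h F = h E].

Lemma head_decomposition_exists (X0 : V) : head_postulate L ->
  exists h d, head_decomposition h d.
Proof.
move=> /(canonical_heads X0)[h hP]; exists h.
have /choice[d dP] E : exists s, ~ is_var E ->
    [/\ ~ is_var (h E), is_inst s (h E) E,
        forall X, ~ fv (h E) X -> s X = evar L X
      & forall s' F, is_inst s' E F -> h F = h E].
  have [vE|/hP[[[nh _] /is_prefixP[s hE]] hF]] := pselect (is_var E).
    by exists (evar L).
  exists (fun X => if pselect (fv (h E) X) then s X else evar L X) => _.
  split=> // [|X]; last by case: (pselect (fv (h E) X)).
  apply: is_inst_eq hE => X hX; case: (pselect (fv (h E) X)) => //= _.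
  exact: alpha_refl.
by exists d.
Qed.

End Expressions.

(** * Correctness under instantiation, and translation by recursion on heads *)

Section Translations.
Set Implicit Arguments.
Unset Strict Implicit.
Context {V : Type} {L L' : language V} (S : value L' -> value L -> Prop).
Context (S_alpha : forall (E E' : expr L') (F F' : expr L) eta rho,
  alpha E E' -> alpha F F' ->
  S (sem E eta) (sem F rho) -> S (sem E' eta) (sem F' rho)).

(** [sem_subst] evaluates an instance only up to a renaming of the expression; [S_alpha] absorbs
    that renaming and the choice of instance. *)
Lemma rel_is_inst (E E' : expr L') (F F' : expr L) s t eta rho :
  is_inst s E E' -> is_inst t F F' ->
  S (sem E (fun X => sem (s X) eta)) (sem F (fun X => sem (t X) rho)) ->
  S (sem E' eta) (sem F' rho).
Proof.
move=> EE' FF' SEF.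
have [E1 E1E e1] := sem_subst E (fun X => Some (s X)) eta.
have [F1 F1F e2] := sem_subst F (fun X => Some (t X)) rho.
have EE2 : alpha (inst E s) E'.
  by apply: is_inst_unique (is_inst_inst _ _) EE' _ => X _; exact: alpha_refl.
have FF2 : alpha (inst F t) F'.
  by apply: is_inst_unique (is_inst_inst _ _) FF' _ => X _; exact: alpha_refl.
apply: S_alpha EE2 FF2 _; rewrite /inst e1 e2.
by apply: S_alpha (alpha_sym E1E) (alpha_sym F1F) _.
Qed.

(* Superfluous variables of [T E] are identified with a variable of [E]; when
   [E] has none, [preserves_closed] says that there is nothing to identify. *)
Lemma fv_preserving_translation (T : expr L -> expr L') :
  preserves_closed T -> correct S T ->
  exists T0 : expr L -> expr L', (forall E, fv (T0 E) `<=` fv E) /\ correct S T0.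
Proof.
move=> Tclosed Tcorrect.
have collapse E : exists r : V -> V, (forall X, fv E X -> r X = X) /\
    forall Y, fv (T E) Y -> fv E (r Y).
  have [[X0 EX0]|nE] := pselect (exists X, fv E X).
    exists (fun X => if pselect (fv E X) then X else X0).
    by split=> X; case: (pselect (fv E X)).
  exists id; split=> // Y; rewrite (Tclosed E) //.
  by apply/seteqP; split=> // X EX; case: nE; exists X.
have /choice[r rP] := collapse.
exists (fun E => inst (T E) (fun X => evar L' (r E X))); split=> E.
  move=> Y /(is_inst_fv (is_inst_inst _ _))[X TX /= ->].
  by apply: (rP E).2.
move=> eta rho Srho.
apply: rel_is_inst (is_inst_inst _ _) (iffRL (is_inst_evar E E) (alpha_refl E)) _.
(* [r E] fixes the variables of [E], so collapsing the valuation on this side too leaves the value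
   unchanged. *)
rewrite (sem_fv (rho2 := fun X => sem (evar L (r E X)) rho)); last first.
  by move=> X EX /=; rewrite (rP E).1.
by apply: Tcorrect => X; rewrite !sem_Var.
Qed.

Section HeadRecursion.
Context (h : expr L -> expr L) (d : expr L -> V -> expr L).
Context (hd : head_decomposition h d) (T0 : expr L -> expr L').

Definition head_recursive (T : expr L -> expr L') : Prop :=
  (forall X, T (evar L X) = evar L' X) /\
  forall E, ~ is_var E -> T E = inst (T0 (h E)) (fun X => T (d E X)).

Lemma evar_inj (K : language V) X Y : evar K X = evar K Y -> X = Y.
Proof. by case. Qed.

Lemma head_recursion : exists T, head_recursive T.
Proof.
have d_smaller E X : ~ is_var E -> fv (h E) X -> smaller (d E X) E.
  by move=> /hd[nh hE _ _] hX; exists (h E), (d E), X.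
(* Off the free variables of [h E] no recursive call is available; the default [evar L' X] is right,
   as [d E X] is a variable there. *)
pose step E (T : forall F, smaller F E -> expr L') : expr L' :=
  match pselect (is_var E) with
  | left vE => evar L' (sval (cid vE))
  | right nE => inst (T0 (h E)) (fun X =>
      match pselect (fv (h E) X) with
      | left hX => T (d E X) (d_smaller E X nE hX)
      | right _ => evar L' X
      end)
  end.
pose T := Fix smaller_wf (fun _ => expr L') step.
have T_eq E : T E = step E (fun F _ => T F).
  apply: (Fix_eq smaller_wf (fun _ => expr L')) => F f g fg.
  by congr step; apply/functional_extensionality_dep => G;
     apply/functional_extensionality_dep => GF; exact: fg.
have T_evar X : T (evar L X) = evar L' X.
  rewrite T_eq /step; case: pselect => [vX|[]]; last by exists X.
  by case: (cid vX) => Y /= /evar_inj ->.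
exists T; split=> // E nE; rewrite T_eq /step; case: pselect => // nE'.
congr inst; apply/funext => X; case: pselect => // nX.
by have [_ _ -> //] := hd nE; rewrite T_evar.
Qed.

Lemma head_ind (P : expr L -> Prop) : (forall X, P (evar L X)) ->
  (forall E, ~ is_var E -> (forall X, fv (h E) X -> P (d E X)) -> P E) ->
  forall E, P E.
Proof.
move=> Pvar Phead; elim/(well_founded_ind (@smaller_wf V L)) => E IH.
have [[X ->]|nE] := pselect (is_var E); first exact: Pvar.
apply: Phead => // X hX; apply: IH; have [nh hE _ _] := hd nE.
by exists (h E), (d E), X.
Qed.

Context (T0_fv : forall E, fv (T0 E) `<=` fv E) (T : expr L -> expr L').
Context (T_rec : head_recursive T).

Lemma head_recursive_is_inst E : ~ is_var E -> is_inst (fun X => T (d E X)) (T0 (h E)) (T E).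
Proof. by move=> /T_rec.2 ->; exact: is_inst_inst. Qed.

Lemma head_recursive_fv E : fv (T E) `<=` fv E.
Proof.
elim/head_ind: E => [X|E nE IH] Y; first by rewrite T_rec.1.
move=> /(is_inst_fv (head_recursive_is_inst nE))[X /T0_fv hX /(IH _ hX)].
by have [_ hE _ _] := hd nE; exact: fv_is_inst hE hX _.
Qed.

(** Both have the same canonical head, and cancellation makes their arguments agree up to renaming;
    by [T0_fv] no other arguments enter. *)
Lemma head_recursive_alpha E F : alpha E F -> alpha (T E) (T F).
Proof.
elim/head_ind: E F => [X|E nE IH] F.
  by move=> /ralphaP /= e; rewrite (_ : F = evar L X) //; [exact: alpha_refl|exact: expr_eq].
move=> EF; have EF' := iffRL (is_inst_evar E F) EF.
have nF : ~ is_var F by move=> /(is_inst_is_var EF').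
have [_ hE _ hEF] := hd nE; have [_ hF _ _] := hd nF.
have TF := head_recursive_is_inst nF; rewrite (hEF _ _ EF') in hF TF.
apply: is_inst_unique (head_recursive_is_inst nE) TF _ => X /T0_fv hX.
exact: IH hX _ (is_inst_inj hE hF EF hX).
Qed.

Lemma head_recursive_subst s E F : is_inst s E F -> is_inst (fun X => T (s X)) (T E) (T F).
Proof.
elim/head_ind: E F => [X|E nE IH] F EF.
  by rewrite T_rec.1; apply/is_inst_Var/head_recursive_alpha/is_inst_Var.
have nF : ~ is_var F by move=> /(is_inst_is_var EF).
have [_ hE _ hEF] := hd nE; have [_ hF _ _] := hd nF.
have TF := head_recursive_is_inst nF; rewrite (hEF _ _ EF) in hF TF.
(* By cancellation at the common head, the arguments of [F] are those of [E] instantiated by [s]. *)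
have dEF X : fv (h E) X -> is_inst s (d E X) (d F X).
  move=> hX; apply: is_inst_alphar (is_inst_inst _ s) _.
  apply: (is_inst_inj (s := fun X => inst (d E X) s) _ hF (alpha_refl F) hX).
  by apply: is_inst_comp hE EF _ => Y _; exact: is_inst_inst.
apply: is_inst_alphar (is_inst_inst _ _) _.
apply: is_inst_unique TF _ => [|X _]; last exact: alpha_refl.
apply: is_inst_comp (head_recursive_is_inst nE) (is_inst_inst _ _) _ => X /T0_fv hX.
exact: IH hX _ (dEF X hX).
Qed.

Lemma head_recursive_correct : correct S T0 -> correct S T.
Proof.
move=> T0_correct E eta rho Srho; elim/head_ind: E => [X|E nE IH].
  by rewrite T_rec.1 !sem_Var.
have [_ hE dE _] := hd nE.
(* Correctness of [T0] at the head is used for the valuations given by the arguments, which are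
   related by induction. *)
apply: rel_is_inst (head_recursive_is_inst nE) hE _; apply: T0_correct => X.
have [hX|/dE ->] := pselect (fv (h E) X); first exact: IH.
by rewrite T_rec.1 !sem_Var.
Qed.

End HeadRecursion.
End Translations.

(** The Alpha Postulates enter here: transitivity merges a renaming into the [val_alpha] steps at
    either end of [rel_alpha]. *)
Lemma rel_alpha_alpha (V : Type) (L L' : language V) (R : value L' -> value L -> Prop)
    (E E' : expr L') (F F' : expr L) eta rho :
  alpha_postulate L -> alpha_postulate L' -> alpha E E' -> alpha F F' ->
  rel_alpha R (sem E eta) (sem F rho) -> rel_alpha R (sem E' eta) (sem F' rho).
Proof.
move=> [_ _ tL] [_ _ tL'] EE' FF' [w [v [Ew Rwv vF]]]; exists w, v; split=> //.
  by apply: tL' Ew; exists E', E, eta; split=> //; exact: alpha_sym.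
by apply: tL vF _; exists F, F', rho.
Qed.

Theorem theorem5 (V : Type) (V_infinite : infinite_set [set: V])
    (L L' : language V)
    (head_L : head_postulate L) (head_L' : head_postulate L')
    (alpha_L : alpha_postulate L) (alpha_L' : alpha_postulate L')
    (R : value L' -> value L -> Prop) (semantic_R : semantic_translation R) :
  (exists T : expr L -> expr L',
     preserves_closed T /\ correct (rel_alpha R) T) ->
  exists T : expr L -> expr L',
    [/\ preserves_closed T, compositional T & correct (rel_alpha R) T].
Proof.
have [X0 _] := infinite_setN0 V_infinite.
have R_alpha E E' F F' eta rho := @rel_alpha_alpha V L L' R E E' F F' eta rho alpha_L alpha_L'.
move=> [T1 [T1_closed T1_correct]].
have [T0 [T0_fv T0_correct]] := fv_preserving_translation R_alpha T1_closed T1_correct.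
have [h [d hd]] := head_decomposition_exists X0 head_L.
have [T T_rec] := head_recursion hd T0.
exists T; split; last exact: (head_recursive_correct R_alpha hd T_rec T0_correct).
  by move=> E E0; rewrite -subset0 -E0; exact: (head_recursive_fv hd T0_fv T_rec).
split; last exact: T_rec.1.
  move=> E s _; have TE := head_recursive_subst hd T0_fv T_rec (is_inst_subst s E).
  apply: is_inst_unique TE (is_inst_subst _ _) _ => X _.
  by case: (s X) => [F|] /=; rewrite ?T_rec.1; exact: alpha_refl.
by move=> E F; exact: (head_recursive_alpha hd T0_fv T_rec).
Qed.
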